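(* Let $p$ be a prime and $\mathbb{F}$ a field of characteristic $p$. Let $X$ be a (finite) simplicial complex of dimension $d$, $k\in\{0,\dots,d\}$, and $\mathcal{F}$ an $\mathbb{F}$-sheaf on $X$ with $h^{k-1}(X,\mathcal{F})=0$ and $h^k(X,\mathcal{F})>h^{k+1}(X,\mathcal{F})$. Put $\rho=(h^k(X,\mathcal{F})-h^{k+1}(X,\mathcal{F}))/\dim C^k(X,\mathcal{F})$. Let $u:Y\to X$ be a covering map of degree $p^r$ that factors as $Y=X_r\to X_{r-1}\to\dots\to X_0=X$ with each $X_i\to X_{i-1}$ a $C_p$-Galois covering. Then (i) $h^k(Y,u^*\mathcal{F})-h^{k+1}(Y,u^*\mathcal{F})\ge\rho\dim C^k(Y,u^*\mathcal{F})$; (ii) consequently $\dim Z^k(Y,u^*\mathcal{F})\ge\rho\dim C^k(Y,u^*\mathcal{F})$ and $h^k(Y,u^*\mathcal{F})\ge\rho\dim C^k(Y,u^*\mathcal{F})$, i.e. the rate of the $k$-cocycle code (resp. $k$-cocycle quantum CSS code) of $(Y,u^*\mathcal{F})$ is at least $\rho$.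
   Context: Simplicial complexes are finite; faces include $\emptyset$. An $\mathbb{F}$-sheaf $\mathcal{F}$ assigns finite-dimensional $\mathbb{F}$-spaces $\mathcal{F}(x)$ to nonempty faces and linear maps $\mathrm{res}_{y\leftarrow x}$ for nonempty $x\subsetneq y$ with $\mathrm{res}_{z\leftarrow y}\mathrm{res}_{y\leftarrow x}=\mathrm{res}_{z\leftarrow x}$. $C^k(X,\mathcal{F})$: alternating families over ordered $k$-faces (for sheaves $C^{-1}=0$), signed coboundary $d_k$, $Z^k=\ker d_k$, $B^k=\mathrm{im}\,d_{k-1}$, $H^k=Z^k/B^k$, $h^k=\dim_{\mathbb{F}}H^k$ (so $h^{-1}=0$). A morphism $u:Y\to X$ of simplicial complexes is a vertex map sending faces to faces; it is a covering map if surjective and for each vertex $y$ it restricts to a bijection from faces containing $y$ to faces containing $u(y)$; degree = common number of preimages of a vertex. A $G$-Galois covering is a covering $u:Y\to X$ with a $G$-action on $Y$ by simplicial automorphisms such that $u(gy)=u(y)$ and $G$ acts simply transitively on $u^{-1}(x)$ for each face $x$; $C_p$ is the cyclic group of order $p$. Pullback: $u^*\mathcal{F}(y)=\mathcal{F}(u(y))$, $\mathrm{res}^{u^*\mathcal{F}}_{y'\leftarrow y}=\mathrm{res}^{\mathcal{F}}_{u(y')\leftarrow u(y)}$. *)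

(* Defs.v *)
From HB Require Import structures.
From mathcomp Require Import all_boot all_order all_fingroup all_algebra all_solvable.

Set Implicit Arguments.
Unset Strict Implicit.
Unset Printing Implicit Defensive.

Import GRing.Theory.
Local Open Scope ring_scope.
Local Open Scope quotient_scope.

(* The library's vectType instance on finite functions only covers the
   constant-fibre case [{ffun I -> vT}]. *)

Definition fam (K : fieldType) (I : finType) (T : I -> vectType K) :=
  {dffun forall i : I, T i}.

Section Fam.
Import VectorInternalTheory.
Variables (K : fieldType) (I : finType) (T : I -> vectType K).
Implicit Types f g h : fam T.

HB.instance Definition _ := Choice.on (fam T).

Definition fam_zero : fam T := [ffun i : I => (0 : T i)].
Definition fam_opp f : fam T := [ffun i : I => - f i].
Definition fam_add f g : fam T := [ffun i : I => f i + g i].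
Definition fam_scale (a : K) f : fam T := [ffun i : I => a *: f i].

Fact fam_addA : associative fam_add.
Proof. by move=> f g h; apply/ffunP=> i; rewrite !ffunE addrA. Qed.
Fact fam_addC : commutative fam_add.
Proof. by move=> f g; apply/ffunP=> i; rewrite !ffunE addrC. Qed.
Fact fam_add0 : left_id fam_zero fam_add.
Proof. by move=> f; apply/ffunP=> i; rewrite !ffunE add0r. Qed.
Fact fam_addN : left_inverse fam_zero fam_opp fam_add.
Proof. by move=> f; apply/ffunP=> i; rewrite !ffunE addNr. Qed.

HB.instance Definition _ :=
  GRing.isZmodule.Build (fam T) fam_addA fam_addC fam_add0 fam_addN.

Fact fam_scaleA a b f : fam_scale a (fam_scale b f) = fam_scale (a * b) f.
Proof. by apply/ffunP=> i; rewrite !ffunE scalerA. Qed.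
Fact fam_scale1 : left_id 1 fam_scale.
Proof. by move=> f; apply/ffunP=> i; rewrite !ffunE scale1r. Qed.
Fact fam_scaleDr : right_distributive fam_scale +%R.
Proof. by move=> a f g; apply/ffunP=> i; rewrite !ffunE scalerDr. Qed.
Fact fam_scaleDl f : {morph fam_scale^~ f : a b / a + b}.
Proof. by move=> a b; apply/ffunP=> i; rewrite !ffunE scalerDl. Qed.

HB.instance Definition _ :=
  GRing.Zmodule_isLmodule.Build K (fam T)
    fam_scaleA fam_scale1 fam_scaleDr fam_scaleDl.

Lemma fam0E i : (0 : fam T) i = 0. Proof. exact: ffunE. Qed.
Lemma famDE f g i : (f + g) i = f i + g i. Proof. exact: ffunE. Qed.
Lemma famNE f i : (- f) i = - f i. Proof. exact: ffunE. Qed.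
Lemma famZE a f i : (a *: f) i = a *: f i. Proof. exact: ffunE. Qed.

Let castT i j (e : i = j) : T i -> T j := fun v => ecast k (T k) e v.

Fact fam_vect_iso :
  Vector.axiom (\sum_(j < #|I|) dim (T (enum_val j))) (fam T).
Proof.
pose fr f := \mxrow_(j < #|I|) (v2r (f (enum_val j)) : 'rV_(dim (T (enum_val j)))).
exists fr.
  move=> a f g; apply/mxrowP => j.
  have subZ (r : 'rV[K]_(\sum_(j < #|I|) dim (T (enum_val j)))) :
    submxrow (a *: r) j = a *: submxrow r j by apply/rowP=> l; rewrite !mxE.
  by rewrite submxrowD subZ !mxrowK famDE famZE linearP.
exists (fun r => [ffun i : I =>
    castT (enum_rankK i) (r2v (submxrow r (enum_rank i)))] : fam T) => [f|r].
  apply/ffunP => i; rewrite ffunE mxrowK v2rK.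
  by move: (enum_rankK i); move: (enum_val _) => j e; case: i / e.
apply/mxrowP => j; rewrite mxrowK ffunE.
have castE k (e : k = j) (e' : enum_val k = enum_val j) :
  v2r (castT e' (r2v (submxrow r k))) = submxrow r j.
  by case: j / e e' => e'; rewrite (eq_irrelevance e' erefl) r2vK.
exact: castE (enum_valK j) _.
Qed.

HB.instance Definition _ := Lmodule_hasFinDim.Build K (fam T) fam_vect_iso.

End Fam.

Section QuotientSpace.
Import VectorInternalTheory.
Variables (K : fieldType) (vT : vectType K) (U : {vspace vT}).

Definition vquot := Quotient.quot (pred_of_vspace U).

HB.instance Definition _ := GRing.Zmodule.on vquot.

Implicit Types q : vquot.

Local Notation repr := generic_quotient.repr.

Let pi (x : vT) : vquot := \pi_(Quotient.quot (pred_of_vspace U)) x.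

Let eq_pi x y : x - y \in U -> pi x = pi y.
Proof. by rewrite Quotient.idealrBE => /eqP. Qed.
Let pi_eq x y : pi x = pi y -> x - y \in U.
Proof. by move=> /eqP; rewrite Quotient.idealrBE. Qed.
Let piK q : pi (repr q) = q. Proof. exact: reprK. Qed.
Let piD x y : pi (x + y) = pi x + pi y. Proof. exact: raddfD. Qed.
Let reprB x : repr (pi x) - x \in U. Proof. by apply: pi_eq; rewrite piK. Qed.

Definition vquot_scale (a : K) q := pi (a *: repr q).

Let piZ a x : vquot_scale a (pi x) = pi (a *: x).
Proof. by apply: eq_pi; rewrite -scalerBr rpredZ. Qed.

Fact vquot_scaleA a b q :
  vquot_scale a (vquot_scale b q) = vquot_scale (a * b) q.
Proof. by rewrite -(piK q) !piZ scalerA. Qed.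
Fact vquot_scale1 : left_id 1 vquot_scale.
Proof. by move=> q; rewrite -(piK q) piZ scale1r. Qed.
Fact vquot_scaleDr : right_distributive vquot_scale +%R.
Proof.
by move=> a q1 q2; rewrite -(piK q1) -(piK q2) -piD !piZ -piD scalerDr.
Qed.
Fact vquot_scaleDl q : {morph vquot_scale^~ q : a b / a + b}.
Proof. by move=> a b; rewrite -(piK q) !piZ -piD scalerDl. Qed.

HB.instance Definition _ :=
  GRing.Zmodule_isLmodule.Build K vquot
    vquot_scaleA vquot_scale1 vquot_scaleDr vquot_scaleDl.

Fact vquot_vect_iso : Vector.axiom (dim (subvs_of (U^C)%VS)) vquot.
Proof.
pose W := subvs_of (U^C)%VS.
pose P x : W := vsproj (U^C)%VS (x - projv U x).
have PD a x y : P (a *: x + y) = a *: P x + P y.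
  rewrite /P -[RHS]linearP; congr (vsproj _ _).
  by rewrite linearP scalerBr opprD addrACA.
have P0 x : x \in U -> P x = 0.
  by move=> xU; rewrite /P projv_id // subrr linear0.
have Pr x : P (repr (pi x)) = P x.
  rewrite -[repr _](subrK x) -[_ - x]scale1r PD P0 ?scaler0 ?add0r //.
exists (fun q => v2r (P (repr q))).
  move=> a q1 q2; rewrite -linearP -PD /=; congr v2r.
  by rewrite -[in RHS]Pr piD -piZ !piK.
exists (fun r => pi (vsval (r2v r : W))) => [q|r] /=.
  rewrite v2rK -[in RHS](piK q); apply: eq_pi.
  by rewrite vsprojK ?memv_projC // addrC addKr rpredN memv_proj.
rewrite Pr -[RHS]r2vK; congr v2r; apply: val_inj.
set w := r2v r; have wC := subvsP w.
rewrite /P /= vsprojK ?memv_projC //.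
suff -> : projv U (vsval w) = 0 by rewrite subr0.
by apply/eqP; rewrite -memv_ker lker_proj.
Qed.

HB.instance Definition _ := Lmodule_hasFinDim.Build K vquot vquot_vect_iso.

Lemma dim_vquot : \dim {: vquot} = (\dim {: vT} - \dim U)%N.
Proof. by rewrite dimvf -dimv_compl. Qed.

End QuotientSpace.

(* The elements of [vert] are exactly the vertices, by [face1]. *)
Record scomplex := SComplex {
  vert :> finType;
  faces : {set {set vert}};
  face0 : set0 \in faces;
  face1 : forall v : vert, [set v] \in faces;
  faceS : forall x y : {set vert}, y \in faces -> x \subset y -> x \in faces
}.

Definition sdim (X : scomplex) : int := (\max_(x in faces X) #|x|)%:Z - 1.

Definition nface (X : scomplex) :=
  {x : {set X} | (x \in faces X) && (x != set0)}.

Record smorph (Y X : scomplex) := SMorph {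
  smap :> Y -> X;
  smap_face : forall y, y \in faces Y -> smap @: y \in faces X
}.

Definition star (X : scomplex) (v : X) : {set {set X}} :=
  [set x in faces X | v \in x].

Definition covering (Y X : scomplex) (u : smorph Y X) : Prop :=
  (forall x : X, exists y : Y, u y = x) /\
  (forall y : Y,
     {in star y &, injective (fun a : {set Y} => u @: a)} /\
     [set u @: a | a : {set Y} in star y] = star (u y)).

Definition has_degree (Y X : scomplex) (u : smorph Y X) (n : nat) : Prop :=
  forall x : X, #|u @^-1: [set x]| = n.

(* The fibre of the empty face is a single face, so simple transitivity on
   fibres is only meaningful over nonempty faces. *)
Definition galois_covering (gT : finGroupType) (Y X : scomplex)
    (u : smorph Y X) : Prop :=
  covering u /\
  exists to : {action gT &-> Y},
    [/\ forall (g : gT) (y : {set Y}),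
          y \in faces Y -> [set to v g | v in y] \in faces Y,
        forall (g : gT) (v : Y), u (to v g) = u v
      & forall x : {set X}, x \in faces X -> x != set0 ->
        forall y y' : {set Y}, y \in faces Y -> y' \in faces Y ->
          u @: y = x -> u @: y' = x ->
          exists! g : gT, [set to v g | v in y] = y'].

Definition cyclic_galois_covering (p : nat) (Y X : scomplex)
    (u : smorph Y X) : Prop :=
  exists gT : finGroupType,
    [/\ cyclic [set: gT], #|[set: gT]| = p & galois_covering gT u].

(* [cyclic_tower p r u]: [u] is the composite of a chain of length [r]
   Y = X_r -> ... -> X_0 = X of C_p-Galois coverings. *)
Inductive cyclic_tower (p : nat) (X : scomplex) :
    nat -> forall Y : scomplex, smorph Y X -> Prop :=
| CyclicTower0 (u : smorph X X) :
    u =1 id -> cyclic_tower p 0 u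
| CyclicTowerS (r : nat) (Z Y : scomplex)
    (v : smorph Z X) (w : smorph Y Z) (u : smorph Y X) :
    cyclic_tower p r v -> cyclic_galois_covering p w -> u =1 v \o w ->
    cyclic_tower p r.+1 u.

Record sheaf (K : fieldType) (X : scomplex) := Sheaf {
  stalk :> nface X -> vectType K;
  res : forall x y : nface X, val x \proper val y -> 'Hom(stalk x, stalk y);
  res_comp : forall (x y z : nface X) (xy : val x \proper val y)
    (yz : val y \proper val z) (xz : val x \proper val z),
    (res yz \o res xy)%VF = res xz
}.

Section Pullback.
Variables (K : fieldType) (Y X : scomplex) (u : smorph Y X).

Fact nimg_subproof (y : nface Y) :
  (u @: val y \in faces X) && (u @: val y != set0).
Proof.
case: y => y /= /andP[yF y0]; rewrite smap_face //=.
by case/set0Pn: y0 => v vy; apply/set0Pn; exists (u v); apply: imset_f.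
Qed.

Definition nimg (y : nface Y) : nface X := Sub (u @: val y) (nimg_subproof y).

Hypothesis cov_u : covering u.

Fact nimg_proper (y y' : nface Y) :
  val y \proper val y' -> val (nimg y) \proper val (nimg y').
Proof.
case: y y' => [y /= /andP[yF /set0Pn[v vy]]] [y' /= /andP[y'F _]].
move=> pyy'; have syy' := proper_sub pyy'.
rewrite properEneq imsetS // andbT; apply: contraNneq (proper_neq pyy') => uyy'.
apply/eqP; have [+ _] := cov_u.2 v; apply=> //; rewrite inE ?yF ?y'F //.
exact: (subsetP syy').
Qed.

Definition pullback (F : sheaf K X) : sheaf K Y :=
  @Sheaf K Y (fun y => F (nimg y))
    (fun y y' yy' => res F (nimg_proper yy'))
    (fun x y z xy yz xz =>
       res_comp F (nimg_proper xy) (nimg_proper yz) (nimg_proper xz)).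

End Pullback.

Section Cochains.
Variable X : scomplex.

Definition oface (k : nat) :=
  {s : k.+1.-tuple X | uniq s && ([set v in s] \in faces X)}.

HB.instance Definition _ k := Finite.on (oface k).

Fact oset_subproof k (s : oface k) :
  ([set v in val s] \in faces X) && ([set v in val s] != set0).
Proof.
case: s => s /= /andP[_ ->] /=.
by apply/set0Pn; exists (tnth s ord0); rewrite inE mem_tnth.
Qed.

Definition oset k (s : oface k) : nface X :=
  Sub [set v in val s] (oset_subproof s).

Definition perm_tuple k (s : oface k) (sg : 'S_k.+1) : k.+1.-tuple X :=
  [tuple tnth (val s) (sg i) | i < k.+1].

Definition del_tuple k (s : oface k.+1) (i : 'I_k.+2) : k.+1.-tuple X :=
  [tuple tnth (val s) (lift i j) | j < k.+1].

Fact operm_set k (s : oface k) (sg : 'S_k.+1) :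
  [set v in perm_tuple s sg] = [set v in val s].
Proof.
apply/setP=> v; rewrite !inE; apply/tnthP/tnthP => -[i ->].
  by exists (sg i); rewrite tnth_mktuple.
by exists ((sg^-1)%g i); rewrite tnth_mktuple permKV.
Qed.

Fact operm_subproof k (s : oface k) (sg : 'S_k.+1) :
  uniq (perm_tuple s sg) && ([set v in perm_tuple s sg] \in faces X).
Proof.
rewrite operm_set; have /andP[us ->] := valP s.
by rewrite andbT map_inj_uniq ?enum_uniq // => i j /(tuple_uniqP _ us) /perm_inj.
Qed.

Definition operm k (s : oface k) (sg : 'S_k.+1) : oface k :=
  Sub (perm_tuple s sg) (operm_subproof s sg).

Lemma oset_perm k (s : oface k) (sg : 'S_k.+1) : oset s = oset (operm s sg).
Proof. by apply: val_inj; rewrite /= operm_set. Qed.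

Fact odel_sub k (s : oface k.+1) (i : 'I_k.+2) :
  [set v in del_tuple s i] \subset [set v in val s].
Proof.
by apply/subsetP=> v; rewrite !inE => /tnthP[j ->]; rewrite tnth_mktuple mem_tnth.
Qed.

Fact odel_subproof k (s : oface k.+1) (i : 'I_k.+2) :
  uniq (del_tuple s i) && ([set v in del_tuple s i] \in faces X).
Proof.
have /andP[us sF] := valP s; rewrite (faceS sF (odel_sub s i)) andbT.
by rewrite map_inj_uniq ?enum_uniq // => a b /(tuple_uniqP _ us) /lift_inj.
Qed.

Definition odel k (s : oface k.+1) (i : 'I_k.+2) : oface k :=
  Sub (del_tuple s i) (odel_subproof s i).

Fact odel_proper k (s : oface k.+1) (i : 'I_k.+2) :
  val (oset (odel s i)) \proper val (oset s).
Proof.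
rewrite properE odel_sub; apply/subsetPn; exists (tnth (val s) i).
  by rewrite inE mem_tnth.
rewrite inE; apply/tnthP=> -[j]; rewrite tnth_mktuple.
have /andP[us _] := valP s.
by move=> /(tuple_uniqP _ us) /eqP; rewrite (negPf (neq_lift i j)).
Qed.

Variables (K : fieldType) (F : sheaf K X).

Definition stalk_cast (x y : nface X) (e : x = y) (a : F x) : F y :=
  ecast z (F z) e a.

Fact stalk_cast_is_linear x y (e : x = y) : linear (stalk_cast e).
Proof. by case: y / e. Qed.

HB.instance Definition _ x y (e : x = y) :=
  GRing.isLinear.Build K (F x) (F y) _ (stalk_cast e) (stalk_cast_is_linear e).

Definition ofam (k : nat) := fam (fun s : oface k => F (oset s)).

HB.instance Definition _ k := Vector.on (ofam k).

(* Vanishes exactly on the families [f] with f(s o sg) = sgn(sg) f(s). *)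
Definition alt_defect k (s : oface k) (sg : 'S_k.+1) (f : ofam k) :
    F (oset (operm s sg)) :=
  f (operm s sg) - (-1) ^+ odd_perm sg *: stalk_cast (oset_perm s sg) (f s).

Fact alt_defect_is_linear k (s : oface k) sg : linear (alt_defect s sg).
Proof.
move=> a f g; rewrite /alt_defect !famDE !famZE linearP.
by rewrite scalerDr opprD addrACA scalerBr !scalerA [_ * a]mulrC.
Qed.

HB.instance Definition _ k (s : oface k) sg :=
  GRing.isLinear.Build K (ofam k) (F (oset (operm s sg))) _
    (alt_defect s sg) (alt_defect_is_linear s sg).

Definition cochains (k : nat) : {vspace ofam k} :=
  (\bigcap_(s : oface k) \bigcap_(sg : 'S_k.+1) lker (linfun (alt_defect s sg)))%VS.

Lemma cochainsP k (f : ofam k) :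
  reflect (forall (s : oface k) (sg : 'S_k.+1),
             f (operm s sg) =
             (-1) ^+ odd_perm sg *: stalk_cast (oset_perm s sg) (f s))
          (f \in cochains k).
Proof.
rewrite memvE; apply: (iffP subv_bigcapP) => [fP s sg|fP s _].
  have /subv_bigcapP/(_ sg isT) := fP s isT.
  by rewrite -memvE memv_ker lfunE /= subr_eq0 => /eqP.
apply/subv_bigcapP=> sg _; rewrite -memvE memv_ker lfunE /= subr_eq0.
exact/eqP/fP.
Qed.

Definition coboundary_fun k (f : ofam k) : ofam k.+1 :=
  [ffun s : oface k.+1 =>
    \sum_(i < k.+2) (-1) ^+ i *: res F (odel_proper s i) (f (odel s i))].

Fact coboundary_is_linear k : linear (@coboundary_fun k).
Proof.
move=> a f g; apply/ffunP=> s; rewrite famDE famZE !ffunE scaler_sumr -big_split.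
apply: eq_bigr => i _ /=; rewrite famDE famZE linearP scalerDr !scalerA.
by rewrite [_ * a]mulrC.
Qed.

HB.instance Definition _ k :=
  GRing.isLinear.Build K (ofam k) (ofam k.+1) _
    (@coboundary_fun k) (@coboundary_is_linear k).

Definition coboundary k : 'Hom(ofam k, ofam k.+1) := linfun (@coboundary_fun k).

Lemma coboundaryE k (f : ofam k) (s : oface k.+1) :
  coboundary k f s =
  \sum_(i < k.+2) (-1) ^+ i *: res F (odel_proper s i) (f (odel s i)).
Proof. by rewrite lfunE /= ffunE. Qed.

Definition cocycles (k : nat) : {vspace ofam k} :=
  (cochains k :&: lker (coboundary k))%VS.

Definition coboundaries (k : nat) : {vspace ofam k} :=
  match k with
  | 0 => 0%VS
  | j.+1 => (coboundary j @: cochains j)%VS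
  end.

Definition cohomology (k : nat) : vectType K :=
  vquot (linfun (vsval : subvs_of (cocycles k) -> ofam k) @^-1: coboundaries k)%VS.

(* h^k = 0 in negative degrees, since C^k = 0 there. *)
Definition hdim (k : int) : nat :=
  if k is Posz n then \dim {: cohomology n} else 0.

Definition cocycle_code_rate (k : nat) : rat :=
  (\dim (cocycles k))%:R / (\dim (cochains k))%:R.

Definition cocycle_css_rate (k : nat) : rat :=
  (hdim k)%:R / (\dim (cochains k))%:R.

End Cochains.

(* Main.v *)
(* Write [c^j] and [b^j] for the dimensions of [C^j] and [B^j], so that
   [h^j = c^j - b^j - b^(j+1)].  When [h^(k-1) = 0], the difference
   [h^k - h^(k+1)] equals [c^k - c^(k+1) - c^(k-1) + b^(k-1) + b^(k+2)], hence
   it suffices that a tower of degree [p^r] multiplies each [c^j] by [p^r]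
   exactly and each [b^j] by [p^r] at least.

   For a Galois covering with cyclic group of order [q], a power of the
   characteristic, let [s] be the translation by a generator and [T = s - 1].
   Then [T^q = s^q - 1 = 0] and [T^(q-1)] is the norm [1 + s + ... + s^(q-1)],
   so that [q * dim (T^(q-1) W) <= dim W <= q * dim (W :&: ker T)] on every
   [s]-stable space [W] of cochains.  As the group acts freely on faces, the
   norms of cochains and the fixed cochains are both exactly the pullbacks of
   cochains from the base. *)

From HB Require Import structures.
Require Import Defs.
From mathcomp Require Import all_boot all_order all_fingroup all_algebra.
From mathcomp Require Import all_solvable zify.

Set Implicit Arguments.
Unset Strict Implicit.
Unset Printing Implicit Defensive.

Import Order.TTheory GRing.Theory Num.Theory.
Local Open Scope ring_scope.

(** * Dimensions under a nilpotent operator *)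

Lemma limg_dim_lker0 (K : fieldType) (aT rT : vectType K) (f : 'Hom(aT, rT))
    (U : {vspace aT}) :
  lker f == 0%VS -> \dim (f @: U) = \dim U.
Proof. by move=> /eqP f0; apply: limg_dim_eq; rewrite f0 capv0. Qed.

Section IteratedImage.
Variables (K : fieldType) (vT : vectType K) (f : 'End(vT)).
Implicit Types W : {vspace vT}.

Lemma mem_iter_limgP n W v :
  reflect (exists2 w, w \in W & v = iter n f w) (v \in iter n (lfun_img f) W).
Proof.
elim: n v => [|n IHn] v /=.
  by apply: (iffP idP) => [vW|[w wW ->]] //; exists v.
apply: (iffP memv_imgP) => [[_ /IHn[w wW ->] ->]|[w wW ->]]; first by exists w.
by exists (iter n f w) => //; apply/IHn; exists w.
Qed.

Lemma iter_limg_eq0 n W :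
  {in W, forall w, iter n f w = 0} -> iter n (lfun_img f) W = 0%VS.
Proof.
move=> fn0; apply/eqP; rewrite -subv0; apply/subvP=> _ /mem_iter_limgP[w wW ->].
by rewrite fn0 ?mem0v.
Qed.

Lemma dim_iter_limg n W :
  \dim W = (\sum_(i < n) \dim (iter i (lfun_img f) W :&: lker f) +
            \dim (iter n (lfun_img f) W))%N.
Proof.
by elim: n => [|n IHn]; rewrite ?big_ord0 // big_ord_recr -addnA limg_ker_dim.
Qed.

Variable W : {vspace vT}.
Hypothesis f_stable : (f @: W <= W)%VS.

Lemma iter_limg_sub i j :
  (i <= j)%N -> (iter j (lfun_img f) W <= iter i (lfun_img f) W)%VS.
Proof.
move/subnKC<-; elim: (j - i)%N => [|n IHn]; first by rewrite addn0.
rewrite addnS; apply: subv_trans IHn; elim: (i + n)%N => //= m; exact: limgS.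
Qed.

Lemma nilpotent_dim_le_ker n :
  {in W, forall w, iter n f w = 0} -> (\dim W <= n * \dim (W :&: lker f))%N.
Proof.
move=> /iter_limg_eq0 fn0; rewrite [leqLHS](dim_iter_limg n) fn0 dimv0 addn0.
rewrite -[n in leqRHS]card_ord -sum_nat_const; apply: leq_sum => i _.
exact/dimvS/capvS/subvv/(iter_limg_sub (leq0n i)).
Qed.

Lemma nilpotent_dim_ge_limg n :
  {in W, forall w, iter n.+1 f w = 0} ->
  (n.+1 * \dim (iter n (lfun_img f) W) <= \dim W)%N.
Proof.
move=> /iter_limg_eq0 fn0; rewrite [leqRHS](dim_iter_limg n.+1) fn0 dimv0 addn0.
rewrite -[n.+1 in leqLHS]card_ord -sum_nat_const; apply: leq_sum => i _.
by apply: dimvS; rewrite subv_cap iter_limg_sub -1?ltnS //= lkerE; exact/eqP.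
Qed.

End IteratedImage.

Lemma expr_sub1_pchar (K : fieldType) (A : algType K) (x : A) q :
  [pchar K].-nat q -> (x - 1) ^+ q.-1 = \sum_(i < q) x ^+ i.
Proof.
move=> charq; have q_gt0 : (0 < q)%N by case/andP: charq.
suff polyE : ('X - 1) ^+ q.-1 = \sum_(i < q) 'X^i :> {poly K}.
  have := congr1 (horner_alg x) polyE.
  rewrite rmorphXn rmorphB rmorph1 rmorph_sum /= horner_algX => ->.
  by apply: eq_bigr => i _; rewrite rmorphXn /= horner_algX.
(* Both sides, multiplied by ['X - 1], give ['X^q - 1]. *)
have X1_neq0 : 'X - 1 != 0 :> {poly K} by rewrite -polyC1 polyXsubC_eq0.
apply: (mulfI X1_neq0); rewrite -exprS prednK // -subrX1.
have charPq : [pchar {poly K}].-nat q by rewrite (eq_pnat _ (@pchar_poly K)).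
by rewrite exprDn_pchar // exprNn_pchar // expr1n.
Qed.

Section CyclicOperator.
Variables (K : fieldType) (vT : vectType K) (s : 'End(vT)) (q : nat).
Hypothesis charq : [pchar K].-nat q.

Lemma iter_sub1_pchar v : iter q.-1 (s - \1)%VF v = \sum_(i < q) iter i s v.
Proof.
(* ['End(vT)] is an algebra only when [vT] is not the zero space. *)
have [vT0|vT_gt0] := posnP (dim vT).
  have eq0 (w : vT) : w = 0.
    apply/eqP; rewrite -memv0 (_ : 0%VS = fullv) ?memvf //.
    by apply/esym/eqP; rewrite -dimv_eq0 dimvf vT0.
  by rewrite [LHS]eq0 [RHS]eq0.
have exprE (f : lfun_algType vT_gt0) n w :
    (f ^+ n : 'End(vT)) w = iter n (f : 'End(vT)) w.
  elim: n => [|n IHn]; first by rewrite expr0 id_lfunE.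
  by rewrite exprSr [LHS]comp_lfunE IHn.
have := congr1 (fun f : 'End(vT) => f v)
  (expr_sub1_pchar (s : lfun_algType vT_gt0) charq).
rewrite /= exprE => ->; rewrite sum_lfunE.
by apply: eq_bigr => i _; apply: exprE.
Qed.

Variable W : {vspace vT}.
Hypotheses (sW : (s @: W <= W)%VS) (sq : {in W, forall w, iter q s w = w}).

Let q_gt0 : (0 < q)%N. Proof. by case/andP: charq. Qed.

Let sub1_stable : ((s - \1) @: W <= W)%VS.
Proof.
apply/subvP=> _ /memv_imgP[w wW ->]; rewrite add_lfunE opp_lfunE id_lfunE.
by rewrite rpredB // (subvP sW) // memv_img.
Qed.

Let sub1_nilpotent : {in W, forall w, iter q.-1.+1 (s - \1)%VF w = 0}.
Proof.
move=> w wW; rewrite iterS iter_sub1_pchar.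
rewrite add_lfunE opp_lfunE id_lfunE linear_sum /=.
have := telescope_sumr (fun i => iter i s w) (leq0n q).
by rewrite big_mkord sumrB sq // subrr.
Qed.

Lemma cyclic_dim_le_fixed : (\dim W <= q * \dim (W :&: fixedSpace s))%N.
Proof.
by have := nilpotent_dim_le_ker sub1_stable sub1_nilpotent; rewrite prednK.
Qed.

Lemma cyclic_dim_ge_norms (U : {vspace vT}) :
  {in U, forall u, exists2 w, w \in W & u = \sum_(i < q) iter i s w} ->
  (q * \dim U <= \dim W)%N.
Proof.
move=> U_norms; have := nilpotent_dim_ge_limg sub1_stable sub1_nilpotent.
rewrite prednK //; apply: leq_trans; rewrite leq_mul2l dimvS ?orbT //.
apply/subvP=> u /U_norms[w wW ->].
by apply/mem_iter_limgP; exists w => //; rewrite iter_sub1_pchar.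
Qed.

End CyclicOperator.

(** * The cochain complex of a sheaf *)

Lemma lift_perm_surj n (s : 'S_n.+1) (i : 'I_n.+1) :
  exists t : 'S_n, lift_perm i (s i) t = s.
Proof.
pose f k := odflt k (unlift (s i) (s (lift i k))).
have fK k : lift (s i) (f k) = s (lift i k).
  rewrite /f; have := neq_lift i k.
  by rewrite -(inj_eq (@perm_inj _ s)) => /unlift_some[] ? ? ->.
have f_inj : injective f.
  by move=> k l /(congr1 (lift (s i))); rewrite !fK => /perm_inj/lift_inj.
exists (perm f_inj); apply/permP=> k.
case: (unliftP i k) => [l|] ->; last by rewrite lift_perm_id.
by rewrite lift_perm_lift permE fK.
Qed.

(* The hypothesis is the simplicial identity between iterated faces, as a
   relation between the terms [(i + 1, j)] and [(j, i)], of opposite signs. *)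
Lemma alternating_double_sum (R : pzRingType) (V : lmodType R) n
    (G : nat -> nat -> V) :
  (forall i j, (j <= i < n)%N -> G i.+1 j = G j i) ->
  \sum_(i < n.+1) \sum_(j < n) (-1) ^+ (i + j) *: G i j = 0.
Proof.
move=> G_simplicial; pose A i j := (-1) ^+ (i + j) *: G i j.
have below : \sum_(i < n.+1) \sum_(j < n | (j < i)%N) A i j =
             - \sum_(i < n) \sum_(j < n | (j <= i)%N) A j i.
  rewrite big_ord_recl big1 // add0r -sumrN; apply: eq_bigr => i _.
  rewrite -sumrN; apply: eq_bigr => j ji.
  rewrite /A lift0 G_simplicial ?ltn_ord ?andbT //.
  by rewrite addSn exprS mulN1r scaleNr addnC.
have above : \sum_(i < n.+1) \sum_(j < n | (i <= j)%N) A i j =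
             \sum_(j < n) \sum_(i < n | (i <= j)%N) A i j.
  rewrite big_ord_recr /= [X in _ + X]big1 ?addr0 => [|j]; last first.
    by rewrite leqNgt ltn_ord.
  by rewrite (exchange_big_dep predT).
rewrite -[RHS](addNr (\sum_(i < n) \sum_(j < n | (j <= i)%N) A j i)).
rewrite -below -above -big_split; apply: eq_bigr => i _ /=.
rewrite [LHS](bigID (fun j : 'I_n => (j < i)%N)); congr (_ + _).
by apply: eq_bigl => j; rewrite -leqNgt.
Qed.

Section CochainComplex.
Variables (X : scomplex) (K : fieldType) (F : sheaf K X).

Lemma tnth_odel k (s : oface X k.+1) i j :
  tnth (val (odel s i)) j = tnth (val s) (lift i j).
Proof. by rewrite tnth_mktuple. Qed.

Lemma tnth_operm k (s : oface X k) t i :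
  tnth (val (operm s t)) i = tnth (val s) (t i).
Proof. by rewrite tnth_mktuple. Qed.

Lemma eq_oface k (s t : oface X k) :
  (forall i, tnth (val s) i = tnth (val t) i) -> s = t.
Proof. by move=> st; apply/val_inj/eq_from_tnth. Qed.

Lemma stalk_castK (x y : nface X) (e : x = y) :
  cancel (stalk_cast (F := F) e) (stalk_cast (esym e)).
Proof. by case: y / e. Qed.

Lemma stalk_castVK (x y : nface X) (e : x = y) :
  cancel (stalk_cast (F := F) (esym e)) (stalk_cast e).
Proof. by case: y / e. Qed.

Lemma res_stalk_cast (x x' y y' : nface X) (ex : x = x') (ey : y = y')
    (xy : val x \proper val y) (x'y' : val x' \proper val y') (a : F x) :
  res F x'y' (stalk_cast ex a) = stalk_cast ey (res F xy a).
Proof.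
by case: x' / ex x'y'; case: y' / ey => xy'; rewrite (eq_irrelevance xy' xy).
Qed.

Lemma eq_res_oface k (s t : oface X k) (y : nface X) (f : ofam F k)
    (sy : val (oset s) \proper val y) (ty : val (oset t) \proper val y) :
  s = t -> res F sy (f s) = res F ty (f t).
Proof.
by move=> st; case: t / st ty => sy'; rewrite (eq_irrelevance sy' sy).
Qed.

Lemma coboundary_coboundary k (f : ofam F k) :
  coboundary F k.+1 (coboundary F k f) = 0.
Proof.
apply/ffunP=> s; rewrite fam0E coboundaryE.
have sub_s i j : val (oset (odel (odel s i) j)) \proper val (oset s).
  exact: proper_trans (odel_proper _ j) (odel_proper s i).
pose G i j := res F (sub_s (inord i) (inord j))
  (f (odel (odel s (inord i)) (inord j))).
rewrite -[RHS](alternating_double_sum (n := k.+2) (G := G)) => [|i j].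
  apply: eq_bigr => i _; rewrite coboundaryE linear_sum scaler_sumr.
  apply: eq_bigr => j _; rewrite linearZ /= scalerA -exprD.
  by rewrite -comp_lfunE (res_comp F _ _ (sub_s i j)) /G !inord_val.
move=> /andP[ji ik]; apply: eq_res_oface; apply: eq_oface => l.
rewrite !tnth_odel; congr tnth; apply: val_inj.
by rewrite /= !inordK ?ltnS ?(leq_ltn_trans ji) // /bump; lia.
Qed.

Lemma coboundary_cochains k :
  (coboundary F k @: cochains F k <= cochains F k.+1)%VS.
Proof.
apply/subvP=> _ /memv_imgP[f /cochainsP f_alt ->]; apply/cochainsP => s t.
rewrite !coboundaryE linear_sum scaler_sumr.
rewrite [RHS](reindex_inj (@perm_inj _ t)) /=; apply: eq_bigr => i _.
have [t' tE] := lift_perm_surj t i.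
have odel_operm : odel (operm s t) i = operm (odel s (t i)) t'.
  apply: eq_oface => l; rewrite tnth_odel !tnth_operm tnth_odel.
  by rewrite -{1}tE lift_perm_lift.
have sub_s :
    val (oset (operm (odel s (t i)) t')) \proper val (oset (operm s t)).
  by rewrite -odel_operm odel_proper.
rewrite (eq_res_oface f _ sub_s odel_operm) f_alt.
rewrite [in LHS]linearZ [in RHS]linearZ /=.
rewrite (res_stalk_cast _ (oset_perm s t) (odel_proper s (t i))) !scalerA.
congr (_ *: _); rewrite -[_ ^+ i]signr_odd -[_ ^+ t i]signr_odd -!signr_addb.
by rewrite -[in RHS]tE odd_lift_perm tE addbAC addbK addbC.
Qed.

Lemma coboundaries_sub_cocycles k : (coboundaries F k <= cocycles F k)%VS.
Proof.
case: k => [|k] /=; first exact: sub0v.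
rewrite subv_cap coboundary_cochains; apply/subvP=> _ /memv_imgP[f _ ->].
by rewrite memv_ker coboundary_coboundary.
Qed.

Lemma dim_cochains k :
  \dim (cochains F k) = (\dim (cocycles F k) + \dim (coboundaries F k.+1))%N.
Proof. by rewrite limg_ker_dim. Qed.

Lemma dim_cocycles (k : nat) :
  \dim (cocycles F k) = (hdim F k + \dim (coboundaries F k))%N.
Proof.
rewrite /= dim_vquot; set f := linfun _.
have fE (z : subvs_of (cocycles F k)) : f z = vsval z by rewrite lfunE.
have f_inj : lker f == 0%VS by apply/lker0P=> z z'; rewrite !fE => /val_inj.
have limg_f : limg f = cocycles F k.
  apply/vspaceP=> z; apply/memv_imgP/idP => [[z' _ ->]|zZ].
    by rewrite fE subvsP.
  by exists (vsproj (cocycles F k) z); rewrite ?memvf // fE vsprojK.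
have B_sub_Z := coboundaries_sub_cocycles k.
rewrite -(limg_dim_lker0 fullv f_inj) -(limg_dim_lker0 (f @^-1: _) f_inj).
by rewrite lpreimK limg_f // subnK // dimvS.
Qed.

Lemma dim_cochains_hdim (k : nat) :
  \dim (cochains F k) =
    (hdim F k + \dim (coboundaries F k) + \dim (coboundaries F k.+1))%N.
Proof. by rewrite dim_cochains dim_cocycles. Qed.

End CochainComplex.

(** * Pulling cochains back *)

Definition nondegenerate (Y X : scomplex) (u : smorph Y X) : Prop :=
  forall y : {set Y}, y \in faces Y -> {in y &, injective u}.

Definition lies_over (Y X : scomplex) (u : smorph Y X)
    (y : nface Y) (x : nface X) : Prop :=
  u @: val y = val x.

Lemma nimg_lies_over (Y X : scomplex) (u : smorph Y X) (y : nface Y) :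
  lies_over u y (nimg u y).
Proof. by []. Qed.

Lemma lies_over_nimg (Y X : scomplex) (u : smorph Y X)
    (y : nface Y) (x : nface X) :
  lies_over u y x -> nimg u y = x.
Proof. by move=> yx; apply: val_inj. Qed.

Lemma imset_set_mem (aT rT : finType) (f : aT -> rT) (s : seq aT) :
  f @: [set x in s] = [set y in map f s].
Proof.
apply/setP=> y; rewrite inE; apply/imsetP/mapP => -[x xs ->]; exists x => //.
  by rewrite inE in xs.
by rewrite inE.
Qed.

Section OrientedImage.
Variables (Y X : scomplex) (u : smorph Y X) (u_inj : nondegenerate u).

Fact oimg_subproof k (s : oface Y k) :
  uniq (map_tuple u (val s)) && ([set v in map_tuple u (val s)] \in faces X).
Proof.
have /andP[s_uniq s_face] := valP s; rewrite -imset_set_mem smap_face // andbT.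
by rewrite map_inj_in_uniq // => v w vs ws; apply: (u_inj s_face); rewrite inE.
Qed.

Definition oimg k (s : oface Y k) : oface X k :=
  Sub (map_tuple u (val s)) (oimg_subproof s).

Lemma tnth_oimg k (s : oface Y k) i :
  tnth (val (oimg s)) i = u (tnth (val s) i).
Proof. by rewrite tnth_map. Qed.

Lemma oimg_operm k (s : oface Y k) t : oimg (operm s t) = operm (oimg s) t.
Proof. by apply: eq_oface => i; rewrite tnth_oimg !tnth_operm tnth_oimg. Qed.

Lemma oimg_odel k (s : oface Y k.+1) i : oimg (odel s i) = odel (oimg s) i.
Proof. by apply: eq_oface => j; rewrite tnth_oimg !tnth_odel tnth_oimg. Qed.

Lemma oset_lies_over k (s : oface Y k) x :
  oimg s = x -> lies_over u (oset s) (oset x).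
Proof. by move=> <-; apply: imset_set_mem. Qed.

End OrientedImage.

(* Identifies [G] with the pullback of [F] along [u].  Indexing the stalk maps
   by the pairs of faces lying over each other avoids transports along
   equalities between faces of [X]. *)
Record pullback_iso (K : fieldType) (Y X : scomplex) (u : smorph Y X)
    (F : sheaf K X) (G : sheaf K Y) := PullbackIso {
  pull_stalk : forall (y : nface Y) (x : nface X),
    lies_over u y x -> 'Hom(F x, G y);
  push_stalk : forall (y : nface Y) (x : nface X),
    lies_over u y x -> 'Hom(G y, F x);
  pull_stalkK : forall (y : nface Y) (x : nface X) (yx : lies_over u y x),
    cancel (pull_stalk yx) (push_stalk yx);
  push_stalkK : forall (y : nface Y) (x : nface X) (yx : lies_over u y x),
    cancel (push_stalk yx) (pull_stalk yx);
  res_pull_stalk : forall (y y' : nface Y) (x x' : nface X)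
      (yx : lies_over u y x) (y'x' : lies_over u y' x')
      (yy' : val y \proper val y') (xx' : val x \proper val x') (a : F x),
    res G yy' (pull_stalk yx a) = pull_stalk y'x' (res F xx' a)
}.

Section CanonicalPullbackIso.
Variables (K : fieldType) (Y X : scomplex) (u : smorph Y X).
Variables (cov_u : covering u) (F : sheaf K X).

Definition canonical_pull_stalk y x (yx : lies_over u y x) :
    'Hom(F x, F (nimg u y)) :=
  linfun (stalk_cast (esym (lies_over_nimg yx))).

Definition canonical_push_stalk y x (yx : lies_over u y x) :
    'Hom(F (nimg u y), F x) :=
  linfun (stalk_cast (lies_over_nimg yx)).

Fact canonical_pull_stalkK y x (yx : lies_over u y x) :
  cancel (canonical_pull_stalk yx) (canonical_push_stalk yx).
Proof. by move=> a; rewrite /canonical_push_stalk !lfunE /= stalk_castVK. Qed.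

Fact canonical_push_stalkK y x (yx : lies_over u y x) :
  cancel (canonical_push_stalk yx) (canonical_pull_stalk yx).
Proof. by move=> a; rewrite /canonical_pull_stalk !lfunE /= stalk_castK. Qed.

Fact res_canonical_pull_stalk (y y' : nface Y) (x x' : nface X)
    (yx : lies_over u y x) (y'x' : lies_over u y' x')
    (yy' : val y \proper val y') (xx' : val x \proper val x') (a : F x) :
  res (pullback cov_u F) yy' (canonical_pull_stalk yx a) =
  canonical_pull_stalk y'x' (res F xx' a).
Proof. by rewrite /canonical_pull_stalk !lfunE /=; exact: res_stalk_cast. Qed.

Definition canonical_pullback_iso : pullback_iso u F (pullback cov_u F) :=
  @PullbackIso K Y X u F (pullback cov_u F)
    canonical_pull_stalk canonical_push_stalk
    canonical_pull_stalkK canonical_push_stalkK res_canonical_pull_stalk.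

End CanonicalPullbackIso.

Section StalkMaps.
Variables (K : fieldType) (Y X : scomplex) (u : smorph Y X).
Variables (F : sheaf K X) (G : sheaf K Y) (phi : pullback_iso u F G).
Implicit Types (y : nface Y) (x : nface X).

Lemma pull_stalk_cast y y' x x' (ey : y = y') (ex : x = x')
    (yx : lies_over u y x) (y'x' : lies_over u y' x') (a : F x) :
  pull_stalk phi y'x' (stalk_cast ex a) = stalk_cast ey (pull_stalk phi yx a).
Proof.
by case: y' / ey y'x'; case: x' / ex => yx'; rewrite (eq_irrelevance yx' yx).
Qed.

Lemma push_stalk_cast y y' x x' (ey : y = y') (ex : x = x')
    (yx : lies_over u y x) (y'x' : lies_over u y' x') (a : G y) :
  push_stalk phi y'x' (stalk_cast ey a) = stalk_cast ex (push_stalk phi yx a).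
Proof.
by case: y' / ey y'x'; case: x' / ex => yx'; rewrite (eq_irrelevance yx' yx).
Qed.

Lemma res_push_stalk y y' x x'
    (yx : lies_over u y x) (y'x' : lies_over u y' x')
    (yy' : val y \proper val y') (xx' : val x \proper val x') (a : G y) :
  res F xx' (push_stalk phi yx a) = push_stalk phi y'x' (res G yy' a).
Proof.
rewrite -[a in RHS](push_stalkK phi yx).
by rewrite (res_pull_stalk phi yx y'x' yy' xx') pull_stalkK.
Qed.

End StalkMaps.

Section RestrictCochain.
Variables (K : fieldType) (Y : scomplex) (G : sheaf K Y) (D : {set {set Y}}).

Definition restrict_cochain k (f : ofam G k) : ofam G k :=
  [ffun s => if val (oset s) \in D then f s else 0].

Lemma restrict_cochains k (f : ofam G k) :
  f \in cochains G k -> restrict_cochain f \in cochains G k.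
Proof.
move=> /cochainsP f_alt; apply/cochainsP=> s t; rewrite !ffunE.
have -> : (val (oset (operm s t)) \in D) = (val (oset s) \in D).
  by rewrite -oset_perm.
by case: ifP => _; rewrite ?f_alt // linear0 scaler0.
Qed.

End RestrictCochain.

Section PullCochains.
Variables (K : fieldType) (Y X : scomplex) (u : smorph Y X).
Variables (u_inj : nondegenerate u).
Variables (F : sheaf K X) (G : sheaf K Y) (phi : pullback_iso u F G).

Definition pull_fun k (f : ofam F k) : ofam G k :=
  [ffun s =>
    pull_stalk phi (oset_lies_over (erefl (oimg u_inj s))) (f (oimg u_inj s))].

Fact pull_is_linear k : linear (@pull_fun k).
Proof.
by move=> a f g; apply/ffunP=> s; rewrite famDE famZE !ffunE linearP.
Qed.

HB.instance Definition _ k :=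
  GRing.isLinear.Build K (ofam F k) (ofam G k) _
    (@pull_fun k) (@pull_is_linear k).

Definition pull k : 'Hom(ofam F k, ofam G k) := linfun (@pull_fun k).

Lemma pullE k (f : ofam F k) s x (e : oimg u_inj s = x) :
  pull k f s = pull_stalk phi (oset_lies_over e) (f x).
Proof. by rewrite lfunE /= ffunE; case: x / e. Qed.

Lemma pull_cochains k : (pull k @: cochains F k <= cochains G k)%VS.
Proof.
apply/subvP=> _ /memv_imgP[f /cochainsP f_alt ->]; apply/cochainsP => s t.
have e : oimg u_inj s = oimg u_inj s by [].
rewrite (pullE _ (oimg_operm u_inj s t)) (pullE _ e) f_alt linearZ /=.
by rewrite (pull_stalk_cast phi (oset_perm s t) _ (oset_lies_over e)).
Qed.

Lemma pull_coboundary k f :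
  pull k.+1 (coboundary F k f) = coboundary G k (pull k f).
Proof.
apply/ffunP=> s; have e : oimg u_inj s = oimg u_inj s by [].
rewrite (pullE _ e) !coboundaryE linear_sum.
apply: eq_bigr => i _; rewrite linearZ /= (pullE _ (oimg_odel u_inj s i)).
by rewrite (res_pull_stalk phi _ (oset_lies_over e) _ (odel_proper _ i)).
Qed.

Lemma pull_coboundaries k :
  (pull k @: coboundaries F k <= coboundaries G k)%VS.
Proof.
case: k => [|k] /=; first by rewrite limg0.
apply/subvP=> _ /memv_imgP[_ /memv_imgP[f fC ->] ->].
rewrite pull_coboundary memv_img //.
exact: (subvP (pull_cochains k)) (memv_img _ fC).
Qed.

Definition base_value k (f : ofam G k) s x (e : oimg u_inj s = x) :
    F (oset x) :=
  push_stalk phi (oset_lies_over e) (f s).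

Lemma eq_base_value k (f g : ofam G k) :
  (forall s x (e : oimg u_inj s = x), base_value f e = base_value g e) -> f = g.
Proof.
move=> fg; apply/ffunP=> s.
exact: (can_inj (push_stalkK phi (oset_lies_over erefl))) (fg s _ erefl).
Qed.

Lemma base_value_oface k (f : ofam G k) s s' x
    (e : oimg u_inj s = x) (e' : oimg u_inj s' = x) :
  s = s' -> base_value f e = base_value f e'.
Proof.
by move=> ss'; case: s' / ss' e' => e'; rewrite (eq_irrelevance e' e).
Qed.

Lemma base_value_sum (I : finType) k (f : I -> ofam G k) s x
    (e : oimg u_inj s = x) :
  base_value (\sum_i f i) e = \sum_i base_value (f i) e.
Proof.
rewrite /base_value -linear_sum; congr (push_stalk _ _ _).
apply: (big_morph (fun h : ofam G k => h s)) => [g h|]; last by rewrite fam0E.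
by rewrite famDE.
Qed.

Lemma base_value_restrict D k (f : ofam G k) s x (e : oimg u_inj s = x) :
  base_value (restrict_cochain D f) e =
  if val (oset s) \in D then base_value f e else 0.
Proof. by rewrite /base_value ffunE; case: ifP; rewrite ?linear0. Qed.

Lemma base_value_pull k (f : ofam F k) s x (e : oimg u_inj s = x) :
  base_value (pull k f) e = f x.
Proof. by rewrite /base_value (pullE _ e) pull_stalkK. Qed.

Lemma base_value_operm k (f : ofam G k) s x (e : oimg u_inj s = x) t
    (et : oimg u_inj (operm s t) = operm x t) :
  f \in cochains G k ->
  base_value f et =
  (-1) ^+ odd_perm t *: stalk_cast (oset_perm x t) (base_value f e).
Proof.
move=> /cochainsP f_alt; rewrite /base_value f_alt linearZ /=.
by rewrite (push_stalk_cast phi _ (oset_perm x t) (oset_lies_over e)).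
Qed.

Hypothesis oimg_surj : forall k (x : oface X k), exists s, oimg u_inj s = x.

Lemma lker0_pull k : lker (pull k) == 0%VS.
Proof.
apply/lker0P=> f g fg; apply/ffunP=> x; have [s e] := oimg_surj x.
by rewrite -(base_value_pull f e) fg base_value_pull.
Qed.

Lemma descend_cochain k (f : ofam G k) :
  f \in cochains G k ->
  (forall s s' x (e : oimg u_inj s = x) (e' : oimg u_inj s' = x),
     base_value f e = base_value f e') ->
  f \in (pull k @: cochains F k)%VS.
Proof.
move=> fC f_const.
have lift_ex x : exists s, oimg u_inj s == x :> oface X k.
  by have [s /eqP] := oimg_surj x; exists s.
have liftK x : oimg u_inj (xchoose (lift_ex x)) = x.
  exact: eqP (xchooseP (lift_ex x)).
pose h : ofam F k := [ffun x => base_value f (liftK x)].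
have hE s x (e : oimg u_inj s = x) : base_value f e = h x.
  by rewrite ffunE; apply: f_const.
apply/memv_imgP; exists h; last first.
  by apply: eq_base_value => s x e; rewrite base_value_pull.
apply/cochainsP=> x t.
have lift_operm : oimg u_inj (operm (xchoose (lift_ex x)) t) = operm x t.
  by rewrite oimg_operm liftK.
rewrite -(hE _ _ lift_operm) -(hE _ _ (liftK x)).
exact: base_value_operm.
Qed.

End PullCochains.

(* With [u = v] and [h] a deck transformation, this is the action of [h] on
   coefficients; with [H] the pullback of [F], it splits off one step of a
   tower. *)
Section FactorPullbackIso.
Variables (K : fieldType) (Y Z X : scomplex).
Variables (h : smorph Y Z) (v : smorph Z X) (u : smorph Y X).
Hypotheses (u_factor : u =1 v \o h) (cov_v : covering v).
Variables (F : sheaf K X) (H : sheaf K Z) (G : sheaf K Y).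
Variables (phi : pullback_iso u F G) (psi : pullback_iso v F H).

Lemma lies_over_comp (y : nface Y) (z : nface Z) (x : nface X) :
  lies_over h y z -> lies_over v z x -> lies_over u y x.
Proof. by rewrite /lies_over (eq_imset _ u_factor) imset_comp => -> ->. Qed.

Definition factor_pull_stalk y z (yz : lies_over h y z) : 'Hom(H z, G y) :=
  (pull_stalk phi (lies_over_comp yz (nimg_lies_over v z))
   \o push_stalk psi (nimg_lies_over v z))%VF.

Definition factor_push_stalk y z (yz : lies_over h y z) : 'Hom(G y, H z) :=
  (pull_stalk psi (nimg_lies_over v z)
   \o push_stalk phi (lies_over_comp yz (nimg_lies_over v z)))%VF.

Fact factor_pull_stalkK y z (yz : lies_over h y z) :
  cancel (factor_pull_stalk yz) (factor_push_stalk yz).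
Proof. by move=> a; rewrite !comp_lfunE pull_stalkK push_stalkK. Qed.

Fact factor_push_stalkK y z (yz : lies_over h y z) :
  cancel (factor_push_stalk yz) (factor_pull_stalk yz).
Proof. by move=> a; rewrite !comp_lfunE pull_stalkK push_stalkK. Qed.

Fact res_factor_pull_stalk (y y' : nface Y) (z z' : nface Z)
    (yz : lies_over h y z) (y'z' : lies_over h y' z')
    (yy' : val y \proper val y') (zz' : val z \proper val z') (a : H z) :
  res G yy' (factor_pull_stalk yz a) = factor_pull_stalk y'z' (res H zz' a).
Proof.
pose z'x' := nimg_lies_over v z'.
have nimg_zz' := nimg_proper cov_v zz'; rewrite !comp_lfunE.
rewrite (res_pull_stalk phi _ (lies_over_comp y'z' z'x') _ nimg_zz').
by rewrite (res_push_stalk psi _ z'x' zz').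
Qed.

Definition factor_pullback_iso : pullback_iso h H G :=
  PullbackIso factor_pull_stalkK factor_push_stalkK res_factor_pull_stalk.

Lemma factor_pull_stalkE (y : nface Y) (z : nface Z) (x : nface X)
    (yz : lies_over h y z) (zx : lies_over v z x) (yx : lies_over u y x)
    (a : H z) :
  factor_pull_stalk yz a = pull_stalk phi yx (push_stalk psi zx a).
Proof.
have nimg_z := lies_over_nimg zx; case: x / nimg_z zx yx => zx yx.
rewrite comp_lfunE (eq_irrelevance (nimg_lies_over v z) zx).
by rewrite (eq_irrelevance (lies_over_comp yz zx) yx).
Qed.

Variables (h_inj : nondegenerate h) (v_inj : nondegenerate v).
Variables (u_inj : nondegenerate u).

Lemma base_value_pull_factor k (f : ofam H k) s x
    (e : oimg u_inj s = x) (e' : oimg v_inj (oimg h_inj s) = x) :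
  base_value phi (pull h_inj factor_pullback_iso k f) e = base_value psi f e'.
Proof.
rewrite /base_value (pullE _ _ (erefl (oimg h_inj s))) /=.
rewrite (factor_pull_stalkE _ (oset_lies_over e') (oset_lies_over e)).
exact: pull_stalkK.
Qed.

End FactorPullbackIso.

(** * Galois coverings *)

Lemma covering_nondegenerate (Y X : scomplex) (u : smorph Y X) :
  covering u -> nondegenerate u.
Proof.
move=> cov_u y y_face v w vy wy uvw; have [star_inj _] := cov_u.2 v.
have vw_face : [set v; w] \in faces Y.
  by apply: faceS y_face _; apply/subsetP=> z /set2P[] ->.
have /setP/(_ w) : [set v; w] = [set v].
  apply: star_inj; rewrite ?inE ?face1 ?vw_face ?eqxx //.
  by rewrite imsetU1 !imset_set1 uvw setUid.
by rewrite !inE eqxx orbT => /esym/eqP.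
Qed.

Lemma covering_face_lift (Y X : scomplex) (u : smorph Y X) (x : nface X) :
  covering u -> exists2 y, y \in faces Y & u @: y = val x.
Proof.
move=> cov_u; have /andP[x_face /set0Pn[w wx]] := valP x.
have [v uv] := cov_u.1 w; have [_ starE] := cov_u.2 v.
have : val x \in star (u v) by rewrite inE x_face uv.
by rewrite -starE => /imsetP[y]; rewrite inE => /andP[y_face _] ->; exists y.
Qed.

Lemma covering_oimg_surj (Y X : scomplex) (u : smorph Y X)
    (u_inj : nondegenerate u) k (x : oface X k) :
  covering u -> exists s, oimg u_inj s = x.
Proof.
move=> /(covering_face_lift (oset x))[y y_face yE].
have vertex_lift i : exists v, (v \in y) && (u v == tnth (val x) i).
  have : tnth (val x) i \in u @: y by rewrite yE inE mem_tnth.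
  by case/imsetP=> v vy ->; exists v; rewrite vy eqxx.
pose s := [tuple xchoose (vertex_lift i) | i < k.+1].
have uE i : u (tnth s i) = tnth (val x) i.
  by rewrite tnth_mktuple; have /andP[_ /eqP] := xchooseP (vertex_lift i).
have s_oface : uniq s && ([set v in s] \in faces Y).
  apply/andP; split.
    have /andP[/tuple_uniqP x_inj _] := valP x.
    by apply/tuple_uniqP => i j sij; apply: x_inj; rewrite -!uE sij.
  apply: faceS y_face _; apply/subsetP=> v; rewrite inE => /tnthP[i ->].
  by rewrite tnth_mktuple; have /andP[] := xchooseP (vertex_lift i).
exists (Sub s s_oface : oface Y k); apply: eq_oface => i.
by rewrite tnth_oimg uE.
Qed.

Lemma big_cycle (R : Type) (idx : R) (op : Monoid.com_law idx)
    (gT : finGroupType) (g : gT) (E : gT -> R) :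
  \big[op/idx]_(h in <[g]>%g) E h = \big[op/idx]_(i < #[g]%g) E (g ^+ i)%g.
Proof.
have powers_inj : injective (fun i : 'I_#[g]%g => g ^+ i)%g.
  by move=> i j /eqP; rewrite eq_expg_mod_order !modn_small // => /eqP/val_inj.
have cycleE : <[g]>%g = [set (g ^+ i)%g | i : 'I_#[g]%g].
  apply/esym/eqP; rewrite eqEcard card_imset // card_ord leqnn andbT.
  by apply/subsetP=> _ /imsetP[i _ ->]; apply: mem_cycle.
by rewrite cycleE big_imset //=; apply: in2W.
Qed.

Section GaloisCovering.
Variables (K : fieldType) (Y X : scomplex) (w : smorph Y X).
Variables (cov_w : covering w).
Variables (F : sheaf K X) (G : sheaf K Y) (phi : pullback_iso w F G).
Variables (gT : finGroupType) (to : {action gT &-> Y}).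
Hypothesis act_face : forall (g : gT) (y : {set Y}),
  y \in faces Y -> [set to v g | v in y] \in faces Y.
Hypothesis act_fibre : forall (g : gT) (v : Y), w (to v g) = w v.
Hypothesis act_simply_transitive :
  forall x : {set X}, x \in faces X -> x != set0 ->
  forall y y' : {set Y}, y \in faces Y -> y' \in faces Y ->
    w @: y = x -> w @: y' = x -> exists! g : gT, [set to v g | v in y] = y'.

Let w_inj : nondegenerate w := covering_nondegenerate cov_w.

Definition act_smorph g : smorph Y Y :=
  @SMorph Y Y (fun v => to v g) (act_face g).

Lemma act_nondegenerate g : nondegenerate (act_smorph g).
Proof. by move=> y _ v v' _ _; apply: act_inj. Qed.

Lemma act_smorph_fibre g : w =1 w \o act_smorph g.
Proof. by move=> v /=; rewrite act_fibre. Qed.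

Definition oact k g (s : oface Y k) : oface Y k :=
  oimg (@act_nondegenerate g) s.

Lemma oimg_oact k g (s : oface Y k) : oimg w_inj (oact g s) = oimg w_inj s.
Proof. by apply: eq_oface => i; rewrite !tnth_oimg /= act_fibre. Qed.

Lemma oact1 k (s : oface Y k) : oact 1%g s = s.
Proof. by apply: eq_oface => i; rewrite tnth_oimg /= act1. Qed.

Lemma oactM k g h (s : oface Y k) : oact (g * h)%g s = oact h (oact g s).
Proof. by apply: eq_oface => i; rewrite !tnth_oimg /= actM. Qed.

Lemma oset_oact k g (s : oface Y k) :
  val (oset (oact g s)) = [set to v g | v in val (oset s)].
Proof. exact/esym/(oset_lies_over (erefl (oact g s))). Qed.

Lemma oact_transitive k (s s' : oface Y k) :
  oimg w_inj s = oimg w_inj s' -> exists g, oact g s = s'.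
Proof.
move=> ss'; have /andP[s_face _] := oset_subproof s.
have /andP[s'_face _] := oset_subproof s'.
have /andP[x_face x_neq0] := oset_subproof (oimg w_inj s).
have [g [gE _]] := act_simply_transitive x_face x_neq0 s_face s'_face
  (oset_lies_over erefl) (oset_lies_over (esym ss')).
exists g; apply: eq_oface => i; apply: (w_inj s'_face).
- by rewrite -gE tnth_oimg imset_f // inE mem_tnth.
- by rewrite inE mem_tnth.
- by rewrite -!(tnth_oimg w_inj) oimg_oact ss'.
Qed.

(* One face in each fibre; freeness makes the translate reaching it unique. *)
Lemma fundamental_domain :
  exists D : {set {set Y}}, forall y, y \in faces Y -> y != set0 ->
  exists! g : gT, [set to v g | v in y] \in D.
Proof.
pose rep (x : {set X}) := odflt set0 [pick y in faces Y | w @: y == x].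
exists [set y : {set Y} | y == rep (w @: y)] => y y_face y_neq0.
have img_act g : w @: [set to v g | v in y] = w @: y.
  by rewrite -imset_comp; apply: eq_imset => v /=; apply: act_fibre.
have [rep_face rep_img] :
    rep (w @: y) \in faces Y /\ w @: rep (w @: y) = w @: y.
  rewrite /rep; case: pickP => [z /andP[? /eqP]|/(_ y)] //.
  by rewrite y_face eqxx.
have wy_face := smap_face w y_face.
have wy_neq0 : w @: y != set0 by rewrite imset_eq0.
have [g [gE g_uniq]] :=
  act_simply_transitive wy_face wy_neq0 y_face rep_face erefl rep_img.
by exists g; split=> [|h]; rewrite inE img_act; [apply/eqP | move/eqP/g_uniq].
Qed.

Definition translate k g : 'End(ofam G k) :=
  pull (@act_nondegenerate g)
    (factor_pullback_iso (@act_smorph_fibre g) cov_w phi phi) k.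

Lemma base_value_translate k g (f : ofam G k) s x (e : oimg w_inj s = x) :
  base_value phi (translate k g f) e =
  base_value phi f (etrans (oimg_oact g s) e).
Proof. exact: base_value_pull_factor. Qed.

Lemma translate1 k (f : ofam G k) : translate k 1 f = f.
Proof.
apply: (eq_base_value (phi := phi)) => s x e.
by rewrite base_value_translate; apply: base_value_oface; apply: oact1.
Qed.

Lemma translateM k g h (f : ofam G k) :
  translate k (g * h)%g f = translate k g (translate k h f).
Proof.
apply: (eq_base_value (phi := phi)) => s x e.
rewrite !base_value_translate; apply: base_value_oface; exact: oactM.
Qed.

Lemma iter_translate k g n (f : ofam G k) :
  iter n (translate k g) f = translate k (g ^+ n)%g f.
Proof. by elim: n => [|n /= ->]; rewrite ?translate1 // expgS translateM. Qed.

Lemma translate_fixed k (f : ofam G k) :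
  f \in cochains G k -> (forall g, translate k g f = f) ->
  f \in (pull w_inj phi k @: cochains F k)%VS.
Proof.
move=> fC f_fixed; apply: descend_cochain => // [k' x|s s' x e e'].
  exact: covering_oimg_surj.
have [g gs] := oact_transitive (etrans e (esym e')).
rewrite -[in LHS](f_fixed g) base_value_translate.
exact: base_value_oface.
Qed.

(* Cutting [pull h] down to a fundamental domain inverts the norm. *)
Lemma pull_norm k (h : ofam F k) : h \in cochains F k ->
  exists2 f, f \in cochains G k &
    pull w_inj phi k h = \sum_(g : gT) translate k g f.
Proof.
move=> hC; have [D D_fundamental] := fundamental_domain.
exists (restrict_cochain D (pull w_inj phi k h)).
  exact/restrict_cochains/(subvP (pull_cochains w_inj phi k))/memv_img.
apply: (eq_base_value (phi := phi)) => s x e.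
rewrite base_value_pull base_value_sum.
under eq_bigr do
  rewrite base_value_translate base_value_restrict base_value_pull oset_oact.
have /andP[s_face s_neq0] := oset_subproof s.
have [g [gD g_uniq]] := D_fundamental _ s_face s_neq0.
rewrite (bigD1 g) //= gD big1 ?addr0 // => g' g'_neq_g.
by case: ifP => // /g_uniq gg'; rewrite gg' eqxx in g'_neq_g.
Qed.

Variable g : gT.
Hypotheses (gen_g : [set: gT] = <[g]>%g) (charg : [pchar K].-nat #[g]%g).

Lemma pull_cyclic_norm k (h : ofam F k) : h \in cochains F k ->
  exists2 f, f \in cochains G k &
    pull w_inj phi k h = \sum_(i < #[g]%g) iter i (translate k g) f.
Proof.
move=> /pull_norm[f fC ->]; exists f => //.
under eq_bigl => h' do rewrite -[true](in_setT h') gen_g.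
by rewrite big_cycle; apply: eq_bigr => i _; rewrite iter_translate.
Qed.

Let translate_period k (U : {vspace ofam G k}) :
  {in U, forall f, iter #[g]%g (translate k g) f = f}.
Proof. by move=> f _; rewrite iter_translate expg_order translate1. Qed.

Let lker0_pull_covering k : lker (pull w_inj phi k) == 0%VS.
Proof. by apply: lker0_pull => k' x; apply: covering_oimg_surj. Qed.

Lemma dim_cochains_cyclic_galois k :
  \dim (cochains G k) = (#[g]%g * \dim (cochains F k))%N.
Proof.
have translate_stable : (translate k g @: cochains G k <= cochains G k)%VS.
  exact: pull_cochains.
rewrite -(limg_dim_lker0 _ (lker0_pull_covering k)).
apply/anti_leq/andP; split; last first.
  apply: (cyclic_dim_ge_norms charg translate_stable (@translate_period _ _)).
  by move=> _ /memv_imgP[h /pull_cyclic_norm hC ->].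
have := cyclic_dim_le_fixed charg translate_stable (@translate_period _ _).
move/leq_trans; apply; rewrite leq_mul2l dimvS ?orbT //.
apply/subvP=> f; rewrite memv_cap => /andP[fC].
move=> /fixedSpaceP g_fixed; apply: translate_fixed => // h.
have /cycleP[i ->] : h \in <[g]>%g by rewrite -gen_g inE.
by rewrite -iter_translate; elim: i => //= i ->.
Qed.

Lemma dim_coboundaries_cyclic_galois k :
  (#[g]%g * \dim (coboundaries F k) <= \dim (coboundaries G k))%N.
Proof.
case: k => [|k]; first by rewrite dimv0 muln0.
have translate_stable :
    (translate k.+1 g @: coboundaries G k.+1 <= coboundaries G k.+1)%VS.
  exact: pull_coboundaries.
rewrite -(limg_dim_lker0 _ (lker0_pull_covering k.+1)).
apply: (cyclic_dim_ge_norms charg translate_stable (@translate_period _ _)).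
move=> _ /memv_imgP[_ /memv_imgP[h hC ->] ->].
have [f fC hE] := pull_cyclic_norm hC.
exists (coboundary G k f); first exact: memv_img.
rewrite pull_coboundary hE linear_sum; apply: eq_bigr => i _.
by rewrite !iter_translate [RHS]pull_coboundary.
Qed.

End GaloisCovering.

(** * Towers of cyclic coverings *)

Definition scales_dims (n : nat) (K : fieldType) (X Y : scomplex)
    (F : sheaf K X) (G : sheaf K Y) : Prop :=
  forall k, \dim (cochains G k) = (n * \dim (cochains F k))%N /\
            (n * \dim (coboundaries F k) <= \dim (coboundaries G k))%N.

Lemma scales_dims_trans (m n : nat) (K : fieldType) (X Z Y : scomplex)
    (F : sheaf K X) (H : sheaf K Z) (G : sheaf K Y) :
  scales_dims m F H -> scales_dims n H G -> scales_dims (n * m) F G.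
Proof.
move=> FH HG k; have [dimCH dimBH_ge] := FH k; have [dimCG dimBG_ge] := HG k.
split; first by rewrite dimCG dimCH mulnA.
by apply: leq_trans dimBG_ge; rewrite -mulnA leq_mul2l dimBH_ge orbT.
Qed.

Lemma cyclic_galois_scales_dims (n : nat) (K : fieldType) (Y X : scomplex)
    (w : smorph Y X) (F : sheaf K X) (G : sheaf K Y) :
  [pchar K].-nat n -> cyclic_galois_covering n w -> pullback_iso w F G ->
  scales_dims n F G.
Proof.
move=> charn [gT [/cyclicP[g gen_g] card_gT [cov_w [to]]]].
move=> [act_face act_fibre act_trans] phi k.
move: charn; rewrite -card_gT gen_g -orderE => charg; split.
  exact: (dim_cochains_cyclic_galois cov_w phi act_face act_fibre act_trans).
exact: (dim_coboundaries_cyclic_galois cov_w phi act_face act_fibre act_trans).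
Qed.

Lemma imset_eq_id (T : finType) (f : T -> T) (A : {set T}) :
  f =1 id -> f @: A = A.
Proof. by move=> f_id; rewrite (eq_imset _ f_id) imset_id. Qed.

Lemma covering_id (X : scomplex) (u : smorph X X) : u =1 id -> covering u.
Proof.
move=> u_id; have uE (a : {set X}) : u @: a = a by exact: imset_eq_id.
split=> [x|y]; first by exists x.
split=> [a b _ _|]; first by rewrite !uE.
by rewrite (eq_imset _ uE) imset_id u_id.
Qed.

Lemma covering_comp (Y Z X : scomplex)
    (v : smorph Z X) (w : smorph Y Z) (u : smorph Y X) :
  covering v -> covering w -> u =1 v \o w -> covering u.
Proof.
move=> cov_v cov_w uvw; have uE (a : {set Y}) : u @: a = v @: (w @: a).
  by rewrite (eq_imset _ uvw) imset_comp.
split=> [x|y].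
  by have [z <-] := cov_v.1 x; have [y <-] := cov_w.1 z; exists y; rewrite uvw.
have [w_inj wE] := cov_w.2 y; have [v_inj vE] := cov_v.2 (w y).
split=> [a b a_star b_star|].
  rewrite !uE => /v_inj wab; apply: w_inj => //.
  by apply: wab; rewrite -wE imset_f.
by rewrite (eq_imset _ uE) (imset_comp (fun b : {set Z} => v @: b)) wE vE uvw.
Qed.

Lemma trivial_galois_covering (X : scomplex) (u : smorph X X) :
  u =1 id -> cyclic_galois_covering 1 u.
Proof.
move=> u_id; have cov_u := covering_id u_id.
pose trivial_act (v : X) (_ : 'I_1) := v.
have act_trivial : is_action [set: 'I_1] trivial_act by exact: is_total_action.
exists 'I_1; rewrite cardsT card_ord; split=> //.
  rewrite (_ : [set: 'I_1] = 1%g) ?cyclic1 //.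
  by apply/setP=> i; rewrite !inE ord1.
split=> //; exists (Action act_trivial); split=> [g y|//|x _ _ y y' _ _].
  by rewrite imset_id.
rewrite !imset_eq_id // => -> ->; exists 1%g.
by split=> [|g _]; [apply: imset_id | rewrite [g]ord1].
Qed.

Lemma cyclic_tower_covering (p r : nat) (Y X : scomplex) (u : smorph Y X) :
  cyclic_tower p r u -> covering u.
Proof.
elim=> {r Y u} [u|r Z Y v w u _ cov_v [gT [_ _ [cov_w _]]]].
  exact: covering_id.
exact: covering_comp.
Qed.

Lemma cyclic_tower_scales_dims (p r : nat) (K : fieldType) (Y X : scomplex)
    (u : smorph Y X) (F : sheaf K X) (G : sheaf K Y) :
  p \in [pchar K] -> cyclic_tower p r u -> pullback_iso u F G ->
  scales_dims (p ^ r) F G.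
Proof.
move=> charp tower_u.
elim: tower_u G => {r Y u} [u u_id|r Z Y v w u tower_v IHv galois_w uvw] G phi.
  exact: cyclic_galois_scales_dims (trivial_galois_covering u_id) phi.
have cov_v := cyclic_tower_covering tower_v.
have psi := canonical_pullback_iso cov_v F.
rewrite expnS; apply: scales_dims_trans (IHv _ psi) _.
have chi := factor_pullback_iso uvw cov_v phi psi.
apply: cyclic_galois_scales_dims galois_w chi.
by rewrite (eq_pnat _ (pcharf_eq charp)) pnat_id // (pcharf_prime charp).
Qed.

(** * The rate bound *)

Section HdimGap.
Variables (n : nat) (K : fieldType) (X Y : scomplex).
Variables (F : sheaf K X) (G : sheaf K Y).
Hypothesis FG : scales_dims n F G.

Lemma dim_coboundaries_scale k :
  hdim F (k%:Z - 1) = 0%N ->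
  \dim (coboundaries G k) = (n * \dim (coboundaries F k))%N.
Proof.
case: k => [|k]; first by rewrite !dimv0 muln0.
rewrite -addn1 PoszD addrK addn1 => hF0.
apply/anti_leq; rewrite (FG k.+1).2 andbT; have [dimC dimB_ge] := FG k.
by move: dimC; rewrite !dim_cochains_hdim hF0 mulnDr; lia.
Qed.

Lemma hdim_gap k :
  hdim F (k%:Z - 1) = 0%N ->
  (n * hdim F k + hdim G k.+1 <= hdim G k + n * hdim F k.+1)%N.
Proof.
move=> /dim_coboundaries_scale dimB.
have [[[dimC _] [dimC1 _]] [_ dimB2_ge]] := (FG k, FG k.+1, FG k.+2).
by move: dimC dimC1; rewrite !dim_cochains_hdim dimB !mulnDr; lia.
Qed.

Lemma hdim_gap_rate k :
  hdim F (k%:Z - 1) = 0%N -> (hdim F k.+1 < hdim F k)%N ->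
  ((hdim F k)%:R - (hdim F k.+1)%:R) / (\dim (cochains F k))%:R *
    (\dim (cochains G k))%:R <= (hdim G k)%:R - (hdim G k.+1)%:R :> rat.
Proof.
move=> hF0 hF_gt; have dimC_neq0 : (\dim (cochains F k))%:R != 0 :> rat.
  by rewrite pnatr_eq0 dim_cochains_hdim -addnA; lia.
rewrite (FG k).1 natrM mulrCA mulfVK //.
rewrite mulrBr lerBlDr addrAC lerBrDr -!natrM -!natrD ler_nat.
exact: hdim_gap.
Qed.

End HdimGap.

Theorem theorem10p3 (p : nat) (p_prime : prime p)
    (K : fieldType) (charK : p \in [pchar K])
    (X : scomplex) (d : nat) (dimX : sdim X = d%:Z)
    (k : nat) (k_le_d : (k <= d)%N)
    (F : sheaf K X)
    (hkm1 : hdim F (k%:Z - 1) = 0%N)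
    (hk_gt : (hdim F (k%:Z + 1) < hdim F k%:Z)%N)
    (r : nat) (Y : scomplex) (u : smorph Y X) (cov_u : covering u)
    (deg_u : has_degree u (p ^ r)) (tower_u : cyclic_tower p r u) :
  let rho : rat :=
    ((hdim F k%:Z)%:R - (hdim F (k%:Z + 1))%:R) / (\dim (cochains F k))%:R in
  let uF : sheaf K Y := pullback cov_u F in
  rho * (\dim (cochains uF k))%:R
      <= (hdim uF k%:Z)%:R - (hdim uF (k%:Z + 1))%:R
  /\ (rho * (\dim (cochains uF k))%:R <= (\dim (cocycles uF k))%:R
      /\ rho * (\dim (cochains uF k))%:R <= (hdim uF k%:Z)%:R
      /\ rho <= cocycle_code_rate uF k
      /\ rho <= cocycle_css_rate uF k).
Proof.
rewrite -[k%:Z + 1]/((k + 1)%N : int) addn1 in hk_gt *; move=> rho uF.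
have uF_scales : scales_dims (p ^ r) F uF.
  exact: cyclic_tower_scales_dims tower_u (canonical_pullback_iso cov_u F).
have gap_ge := hdim_gap_rate uF_scales hkm1 hk_gt.
have hdim_ge : rho * (\dim (cochains uF k))%:R <= (hdim uF k%:Z)%:R.
  by apply: le_trans gap_ge _; rewrite lerBlDr lerDl ler0n.
have cocycles_ge : rho * (\dim (cochains uF k))%:R <= (\dim (cocycles uF k))%:R.
  by apply: le_trans hdim_ge _; rewrite ler_nat dim_cocycles leq_addr.
have dimC_gt0 : (0 < \dim (cochains uF k))%N.
  rewrite (uF_scales k).1 muln_gt0 expn_gt0 prime_gt0 //.
  by rewrite dim_cochains_hdim -addnA ltn_addr // (leq_ltn_trans _ hk_gt).
by do !split=> //; rewrite ler_pdivlMr ?ltr0n.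
Qed.
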